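(* Let $p\in(0,1]$, and suppose that the density function $\rho:\mathbb{R}\to[0,\infty)$ generating the smoothing function $\phi$ satisfies: (1) $\rho(x)=\rho(-x)$ for all $x\in\mathbb{R}$; (2) $\rho$ is continuous, and nonincreasing on $[0,\infty)$; (3) there exist constants $c,q>0$ such that $2\int_0^S\rho(x)\,dx\ge 1-\frac{c}{S^q+c}$ for all $S\ge 0$; (4) if $p=1$, then $\rho(x)>0$ for all $x\in\mathbb{R}$. Let $(\omega^*,\lambda^*,\zeta^*,\eta^* )$ be any accumulation point of a sequence $\{(\omega^k,\lambda^k,\zeta^k,\eta^k)\}$ generated by the smoothing algorithm. If $p=1$, assume in addition that $$\max_{i\in I(\omega^* )}\left|\frac{\partial G}{\partial\omega_i}(\omega^*,\bar\lambda^* )\right|<\lambda_1^*\psi'(0)$$ (understood as vacuous if $I(\omega^* )=\emptyset$). Then $(\omega^*,\lambda^* )$ is a bilevel KKT (BKKT) point for the bilevel problem $$\min_{\omega^*_\lambda,\lambda} f(\omega^*_\lambda)\ \text{ s.t. }\ \omega^*_\lambda\in\operatorname{argmin}_{\omega\in\mathbb{R}^n}\{G(\omega,\bar\lambda)+\lambda_1R_1(\omega)\},\ \lambda\in\Omega_\epsilon .$$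
   Context: **Data.** $n,r\ge1$; $f:\mathbb{R}^n\to\mathbb{R}$ is continuously differentiable; $g,R_2,\dots,R_r:\mathbb{R}^n\to\mathbb{R}$ are twice continuously differentiable; $p\in(0,1]$; $\epsilon>0$ is a fixed (small) parameter. The function $\psi:[0,\infty)\to\mathbb{R}$ is twice continuously differentiable on $[0,\infty)$ and there are constants $\alpha,\beta>0$ with $0<\psi'(t)\le\alpha$ and $-\beta\le\psi''(t)\le0$ for all $t\ge0$. Set $R_1(\omega)=\sum_{i=1}^n\psi(|\omega_i|^p)$. For $\lambda=(\lambda_1,\dots,\lambda_r)\in\mathbb{R}^r$ write $\bar\lambda=(\lambda_2,\dots,\lambda_r)$ and $G(\omega,\bar\lambda)=g(\omega)+\sum_{i=2}^r\lambda_iR_i(\omega)$. Let $\Omega_\epsilon=\{\lambda\in\mathbb{R}^r:\lambda_1\ge\epsilon,\ \lambda_i\ge0\ (i\ge2)\}$, $e_1=(1,0,\dots,0)\in\mathbb{R}^r$, $I(\omega)=\{j:\omega_j=0\}$. Inequalities between vectors are componentwise; $\operatorname{sgn}$ is the sign function with $\operatorname{sgn}(0)=0$. **Smoothing function.** $\rho:\mathbb{R}\to[0,\infty)$ is a probability density with $\int_{\mathbb{R}}|x|\rho(x)\,dx<\infty$, and for $\mu>0$, $\phi(\mu,x)=\int_{\mathbb{R}}|x-t|\frac1\mu\rho\left(\frac t\mu\right)dt$, $\ \varphi_\mu(\omega)=\sum_{j=1}^n\psi\left([\phi(\mu,\omega_j)]^p\right)$. (Under the hypotheses on $\rho$ in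 the claim, $\varphi_\mu$ is twice continuously differentiable.) **$\hat\varepsilon$-approximate KKT point.** For $\mu>0$ and $\hat\varepsilon\ge0$, a tuple $(\omega,\lambda,\zeta,\eta)\in\mathbb{R}^n\times\mathbb{R}^r\times\mathbb{R}^n\times\mathbb{R}^r$ is an $\hat\varepsilon$-approximate KKT point of the smoothed problem ($\min f(\omega)$ s.t. $\nabla_\omega G(\omega,\bar\lambda)+\lambda_1\nabla\varphi_\mu(\omega)=0$, $\lambda\in\Omega_\epsilon$) if there is $(\varepsilon_1,\varepsilon_2,\varepsilon_3,\varepsilon_4,\varepsilon_5)\in\mathbb{R}^n\times\mathbb{R}\times\mathbb{R}^{r-1}\times\mathbb{R}^n\times\mathbb{R}$ of Euclidean norm at most $\hat\varepsilon$ such that - $\nabla f(\omega)+(\nabla^2_{\omega\omega}G(\omega,\bar\lambda)+\lambda_1\nabla^2\varphi_\mu(\omega))\zeta=\varepsilon_1$, - $\nabla\varphi_\mu(\omega)^T\zeta-\eta_1=\varepsilon_2$, - $\nabla R_j(\omega)^T\zeta-\eta_j=(\varepsilon_3)_{j-1}$ for $j=2,\dots,r$, - $\nabla_\omega G(\omega,\bar\lambda)+\lambda_1\nabla\varphi_\mu(\omega)=\varepsilon_4$, - $\lambda-\epsilon e_1\ge0$, $\eta\ge0$, $(\lambda-\epsilon e_1)^T\eta=\varepsilon_5$. **Smoothing algorithm.** Choose $\mu_0>0$, $\beta_1,\beta_2\in(0,1)$, $\hat\varepsilon_0\ge0$. For $k=0,1,2,\dots$: let $(\omega^{k+1},\lambda^{k+1},\zeta^{k+1},\eta^{k+1})$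 be an $\hat\varepsilon_k$-approximate KKT point of the smoothed problem with $\mu=\mu_k$ (such a point is assumed to be available at every iteration); set $\mu_{k+1}=\beta_1\mu_k$, $\hat\varepsilon_{k+1}=\beta_2\hat\varepsilon_k$. **BKKT point.** $(\omega^*,\lambda^* )\in\mathbb{R}^n\times\mathbb{R}^r$ is a BKKT point if there is $(\zeta^*,\eta^* )\in\mathbb{R}^n\times\mathbb{R}^r$ such that, with $\tilde\omega^*=(\omega_i^* )_{i\notin I(\omega^* )}$, $\tilde\zeta^*=(\zeta_i^* )_{i\notin I(\omega^* )}$ and $\nabla_{\tilde\omega}$ denoting differentiation in the coordinates $\omega_i$, $i\notin I(\omega^* )$, - $\nabla_{\tilde\omega}f(\omega^* )+\widetilde H\tilde\zeta^*=0$, where $\widetilde H=\nabla^2_{\tilde\omega\tilde\omega}G(\omega^*,\bar\lambda^* )+\operatorname{diag}\left(\lambda_1^*p(p-1)|\omega_i^*|^{p-2}\psi'(|\omega_i^*|^p)+\lambda_1^*p^2|\omega_i^*|^{2p-2}\psi''(|\omega_i^*|^p)\right)_{i\notin I(\omega^* )}$, - $\frac{\partial G}{\partial\omega_i}(\omega^*,\bar\lambda^* )+p\lambda_1^*\psi'(|\omega_i^*|^p)|\omega_i^*|^{p-1}\operatorname{sgn}(\omega_i^* )=0$ for $i\notin I(\omega^* )$, - $\zeta_i^*=0$ for $i\in I(\omega^* )$, - $p\sum_{i\notin I(\omega^* )}\psi'(|\omega_i^*|^p)|\omega_i^*|^{p-1}\operatorname{sgn}(\omega_i^* )\zeta_i^*=\eta_1^*$,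 - $\nabla_{\tilde\omega}R_j(\omega^* )^T\tilde\zeta^*=\eta_j^*$ for $j=2,\dots,r$, - $\lambda^*-\epsilon e_1\ge0$, $\eta^*\ge0$, $(\lambda^*-\epsilon e_1)^T\eta^*=0$. *)

(* Defs.v *)
From mathcomp Require Import all_boot all_order all_algebra.
From mathcomp Require Import all_classical all_reals all_analysis.

Set Implicit Arguments.
Unset Strict Implicit.
Unset Printing Implicit Defensive.
Import Order.TTheory GRing.Theory Num.Theory.
Import numFieldNormedType.Exports.

Local Open Scope classical_set_scope.
Local Open Scope ring_scope.

(** Vectors are columns. The topology of ['cV[R]_n] in the library comes from
    the sup norm; the Euclidean norm enters only through [dotv]. *)
Definition dotv (R : realType) (n : nat) (u v : 'cV[R]_n) : R :=
  \sum_i u i 0 * v i 0.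

Section Differentiation.
Context {R : realType} {n : nat}.
Implicit Types (F : 'cV[R]_n -> R) (w : 'cV[R]_n).

Definition partial (i : 'I_n) F w : R := 'D_(delta_mx i 0 : 'cV[R]_n) F w.

Definition grad F w : 'cV[R]_n := \col_i partial i F w.

Definition hess F w : 'M[R]_n := \matrix_(i, j) partial j (partial i F) w.

Definition C1 F : Prop :=
  (forall w, differentiable F w) /\ (forall i, continuous (partial i F)).

Definition C2 F : Prop := C1 F /\ (forall i, C1 (partial i F)).

End Differentiation.

(** Calculus on the half-line [[0, +oo[]: derivatives at [0] are one-sided, and
    the values of a function at negative arguments are never used. *)
Section HalfLine.
Context {R : realType}.
Implicit Types (psi : R -> R) (t : R).

Definition derivable_nneg psi t : Prop :=
  cvg ((h^-1 * (psi (t + h) - psi t)) @[h --> within [set h | 0 <= t + h] 0^']).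

Definition deriv_nneg psi t : R :=
  lim ((h^-1 * (psi (t + h) - psi t)) @[h --> within [set h | 0 <= t + h] 0^']).

Definition C1_nneg psi : Prop :=
  (forall t, 0 <= t -> derivable_nneg psi t) /\
  {within `[0, +oo[, continuous (deriv_nneg psi)}.

Definition C2_nneg psi : Prop := C1_nneg psi /\ C1_nneg (deriv_nneg psi).

End HalfLine.

Section Smoothing.
Context {R : realType}.
Local Notation leb := (@lebesgue_measure R).

Definition is_density (rho : R -> R) : Prop :=
  [/\ measurable_fun setT rho, forall x, 0 <= rho x
    & (\int[leb]_x (rho x)%:E = 1)%E].

Definition finite_first_moment (rho : R -> R) : Prop :=
  (\int[leb]_x (`|x| * rho x)%:E < +oo)%E.

Definition phi (rho : R -> R) (mu x : R) : R :=
  \int[leb]_(t in setT) (`|x - t| * (mu^-1 * rho (t / mu))).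

Definition varphi (psi rho : R -> R) (p : R) (n : nat) (mu : R) (w : 'cV[R]_n) : R :=
  \sum_j psi (phi rho mu (w j 0) `^ p).

End Smoothing.

(** The hyperparameters are [lam : 'cV[R]_r.+1]: the entry [lam 0 0] is
    lambda_1, and [Rs j], for [j : 'I_r], is the regularizer R_{j+2}, weighted by
    [lam (lift ord0 j) 0]. *)
Section Bilevel.
Context {R : realType} {n r : nat}.
Implicit Types (w zeta : 'cV[R]_n) (lam eta : 'cV[R]_r.+1).

Definition lbar lam : 'cV[R]_r := \col_j lam (lift ord0 j) 0.

Definition Gfun (g : 'cV[R]_n -> R) (Rs : 'I_r -> 'cV[R]_n -> R)
    (lb : 'cV[R]_r) (w : 'cV[R]_n) : R :=
  g w + \sum_j lb j 0 * Rs j w.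

Definition zero_set w : {set 'I_n} := [set j | w j 0 == 0].

Definition iterate : Type := 'cV[R]_n * 'cV[R]_r.+1 * 'cV[R]_n * 'cV[R]_r.+1.

Variables (f g : 'cV[R]_n -> R) (Rs : 'I_r -> 'cV[R]_n -> R).
Variables (p eps : R) (psi : R -> R).

Local Notation G := (Gfun g Rs).
Local Notation e1 := (delta_mx ord0 0 : 'cV[R]_r.+1).
Local Notation psi' := (deriv_nneg psi).
Local Notation psi'' := (deriv_nneg (deriv_nneg psi)).

Definition approx_KKT (rho : R -> R) (mu epshat : R) (z : iterate) : Prop :=
  let: (w, lam, zeta, eta) := z in
  let vphi := varphi psi rho p mu in
  exists (d1 : 'cV[R]_n) (d2 : R) (d3 : 'cV[R]_r) (d4 : 'cV[R]_n) (d5 : R),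
    [/\ Num.sqrt (dotv d1 d1 + d2 ^+ 2 + dotv d3 d3 + dotv d4 d4 + d5 ^+ 2)
          <= epshat,
        grad f w
          + (hess (G (lbar lam)) w + lam ord0 0 *: hess vphi w) *m zeta = d1,
        dotv (grad (vphi : 'cV[R]_n -> R) w) zeta - eta ord0 0 = d2,
        forall j : 'I_r,
          dotv (grad (Rs j) w) zeta - eta (lift ord0 j) 0 = d3 j 0
      & [/\ grad (G (lbar lam)) w + lam ord0 0 *: grad vphi w = d4,
            forall i, 0 <= (lam - eps *: e1) i 0,
            forall i, 0 <= eta i 0
          & dotv (lam - eps *: e1) eta = d5]].

(** [z k.+1] is the point computed at iteration [k]; [z 0] is not constrained. *)
Definition smoothing_algorithm (rho : R -> R) (beta1 beta2 : R)
    (mu epshat : nat -> R) (z : nat -> iterate) : Prop :=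
  [/\ 0 < mu 0%N, 0 < beta1 < 1, 0 < beta2 < 1, 0 <= epshat 0%N
    & forall k, [/\ approx_KKT rho (mu k) (epshat k) (z k.+1),
                    mu k.+1 = beta1 * mu k
                  & epshat k.+1 = beta2 * epshat k]].

(** Entry [(i, j)] of the reduced Hessian; meaningful only for [i] and [j]
    outside [zero_set w], where the diagonal term is lambda_1 times the second
    derivative of x |-> psi (|x|^p). *)
Definition Htilde w lam (i j : 'I_n) : R :=
  hess (G (lbar lam)) w i j
  + (if i == j then
       lam ord0 0 * p * (p - 1) * `|w i 0| `^ (p - 2) * psi' (`|w i 0| `^ p)
       + lam ord0 0 * p ^+ 2 * `|w i 0| `^ (2 * p - 2) * psi'' (`|w i 0| `^ p)
     else 0).

(** Vectors indexed by the complement of [zero_set w] are written by letting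
    their index range over that complement. *)
Definition BKKT w lam : Prop :=
  exists (zeta : 'cV[R]_n) (eta : 'cV[R]_r.+1),
    [/\ forall i, i \notin zero_set w ->
          partial i f w
          + \sum_(j | j \notin zero_set w) Htilde w lam i j * zeta j 0 = 0,
        forall i, i \notin zero_set w ->
          partial i (G (lbar lam)) w
          + p * lam ord0 0 * psi' (`|w i 0| `^ p) * `|w i 0| `^ (p - 1)
            * Num.sg (w i 0) = 0,
        forall i, i \in zero_set w -> zeta i 0 = 0,
        p * (\sum_(i | i \notin zero_set w)
               psi' (`|w i 0| `^ p) * `|w i 0| `^ (p - 1)
               * Num.sg (w i 0) * zeta i 0) = eta ord0 0
      & [/\ forall j : 'I_r,
              \sum_(i | i \notin zero_set w) partial i (Rs j) w * zeta i 0
              = eta (lift ord0 j) 0,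
            forall i, 0 <= (lam - eps *: e1) i 0,
            forall i, 0 <= eta i 0
          & dotv (lam - eps *: e1) eta = 0]].

End Bilevel.

Arguments iterate : clear implicits.

(* Main.v *)
(** With [Phi s = int |s - t| rho t dt], the smoothing function is
    [phi mu x = mu * Phi (x / mu)]. The pointwise subgradient inequality for
    [|.|] gives [S x * (y - x) <= Phi y - Phi x] with [S = 2 K - 1], [K] being the
    distribution function of [rho]; hence [Phi' = S] and [Phi'' = 2 rho].

    Pass to the limit along a filter refining the tail filter, on which the
    iterates converge. Away from [0], [S (x / mu)] tends to the sign of the limit
    and [rho (x / mu) / mu] to [0], so the smoothed penalty converges with its two
    derivatives. At a coordinate [i] with limit [0], the stationarity equation
    makes the first derivative of the smoothed penalty converge. For [p < 1] this
    forces [S (x_i / mu) --> 0], and for [p = 1] the strict inequality on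
    [dG/dw_i] keeps [|S (x_i / mu)|] below a constant smaller than 1; in both cases
    [rho (x_i / mu)] stays bounded below, and the second derivative of the smoothed
    penalty tends to [+oo]. The first KKT equation then forces [zeta_i --> 0]. *)

Require Import Defs.
From mathcomp Require Import all_boot all_order all_algebra.
From mathcomp Require Import all_classical all_reals all_analysis.
From mathcomp Require Import measurable_realfun.
From mathcomp Require Import ring lra.
Import Order.TTheory GRing.Theory Num.Theory.
Import numFieldNormedType.Exports.
Set Implicit Arguments.
Unset Strict Implicit.
Local Open Scope classical_set_scope.
Local Open Scope ring_scope.

(** * Derivatives on the half-line and limits of real powers *)

Section HalfLineCalculus.
Context {R : realType}.

Lemma cvg_of_within {T : Type} {U : topologicalType} (F : set_system T) {FF : Filter F}
    (D : set T) (h : T -> U) (l : U) :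
  F D -> h @ within D F --> l -> h @ F --> l.
Proof.
move=> FD hl A lA; have := hl A lA; rewrite /fmap /= /within /= => H.
by apply: filterS2 FD H => x Dx; apply.
Qed.

(** For [t > 0] every small increment satisfies [0 <= t + h], so the restriction in the one-sided
    filter is eventually void. *)
Lemma is_derive_nneg (psi : R -> R) (t : R) : 0 < t -> derivable_nneg psi t ->
  is_derive t 1 psi (deriv_nneg psi t).
Proof.
move=> t0 dpsi.
have Dt : 0^' [set h | 0 <= t + h].
  apply: (@nbhs_dnbhs _ (0 : R)).
  near=> h; rewrite /= -lerBlDl sub0r lerNl.
  have : `|h| < t by near: h; exact: (@nbhs0_lt R R).
  by rewrite ltr_norml => /andP[/ltW]; lra.
have cv : (fun h => h^-1 *: (psi (h *: 1 + t) - psi t)) @ 0^' --> deriv_nneg psi t.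
  apply: (cvg_of_within Dt).
  rewrite (_ : (fun h => _) = (fun h => h^-1 * (psi (t + h) - psi t))); last first.
    by apply/funext => h; rewrite -[h *: 1]/(h * 1) mulr1 (addrC h t).
  by move: dpsi; rewrite /derivable_nneg /deriv_nneg.
apply: DeriveDef; first by apply/cvg_ex; exists (deriv_nneg psi t).
exact/cvg_lim.
Unshelve. all: end_near. Qed.

Lemma is_derive_mulr (a x : R) : is_derive x 1 (fun y : R => y * a) a.
Proof.
rewrite (_ : (fun y => y * a) = a \*: (id : R -> R)); last first.
  by apply/funext => s; rewrite /= mulrC.
by rewrite -[X in is_derive _ _ _ X]mulr1; exact: is_deriveZ.
Qed.

Context {T : Type} {F : set_system T} {FF : ProperFilter F}.

(** Continuity of [psi'] and [psi''] is relative to the half-line; eventual nonnegativity keeps the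
    argument there, which matters when the limit is [0]. *)
Lemma cvg_within_nneg (k : R -> R) (v : T -> R) (t : R) :
  {within `[0, +oo[, continuous k} -> (\forall m \near F, 0 <= v m) -> 0 <= t ->
  v @ F --> t -> k (v m) @[m --> F] --> k t.
Proof.
move=> /subspace_continuousP kc v0 t0 vt.
have : k @ within `[0, +oo[ (nbhs t) --> k t.
  by apply: kc; rewrite /= in_itv/= t0.
move=> H A /H; rewrite /within /= => HA.
have := vt _ HA; rewrite /fmap/=; apply: filterS2 v0 => m v0; apply.
by rewrite /= in_itv/= v0.
Qed.

Lemma cvg_powR (v : T -> R) (t a : R) :
  0 < t -> v @ F --> t -> v m `^ a @[m --> F] --> t `^ a.
Proof.
move=> t0 vt; have c : {for t, continuous (fun y : R => y `^ a)}.
  apply/differentiable_continuous/derivable1_diffP.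
  by have [] := is_derive1_powR a t0.
exact: (cvg_comp _ _ vt c).
Qed.

(** Handles the limit point [0], where the differentiability argument of [cvg_powR] fails: a bound
    on [v] by [e] to the power [1 / a] gives the bound [e] on the power. *)
Lemma cvg_powR0 (v : T -> R) (a : R) : 0 < a -> (\forall m \near F, 0 <= v m) ->
  v @ F --> 0 -> v m `^ a @[m --> F] --> 0.
Proof.
move=> a0 v0 vt; apply/cvgrPdist_le => e e0.
have ea : 0 < e `^ a^-1 by rewrite powR_gt0.
have /cvgrPdist_le/(_ _ ea) := vt; apply: filterS2 v0 => m v0.
rewrite !sub0r !normrN (ger0_norm v0) ger0_norm ?powR_ge0// => H.
rewrite -[leRHS](powRr1 (ltW e0)) -(mulVf (lt0r_neq0 a0)) powRrM.
by apply: ge0_ler_powR; rewrite ?nnegrE ?powR_ge0// ltW.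
Qed.

End HalfLineCalculus.

(** * Partial derivatives of separable functions and of the lower-level objective *)

Section VectorCalculus.
Context {R : realType} {n : nat}.
Implicit Types (w : 'cV[R]_n) (i j : 'I_n).

(** A directional derivative depends only on increments, so a derivative along a coordinate reduces
    to a one-variable one. *)
Lemma eq_increment_derive (H : 'cV[R]_n -> R) (h : R -> R) (v w : 'cV[R]_n) (x : R) :
  (forall t : R, H (t *: v + w) - H w = h (t *: 1 + x) - h x) ->
  'D_v H w = 'D_1 h x.
Proof.
move=> e; rewrite /derive.
have -> // : (fun t : R => t^-1 *: (H (t *: v + w) - H w)) =
             (fun t : R => t^-1 *: (h (t *: 1 + x) - h x)).
by apply/funext => t; rewrite e.
Qed.

Lemma partial_coord (h : R -> R) i j w :
  partial j (fun v : 'cV[R]_n => h (v i 0)) w =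
  if i == j then 'D_1 h (w i 0) else 0.
Proof.
have [<-|ij] := eqVneq i j.
  by apply: eq_increment_derive => t; rewrite !mxE !eqxx.
rewrite -(derive_cst (0 : R) (0 : R) (1 : R)).
apply: eq_increment_derive => t.
by rewrite !mxE (negbTE ij) /= mulr0 add0r !subrr.
Qed.

Lemma partial_separable (h : R -> R) i w :
  partial i (fun v : 'cV[R]_n => \sum_j h (v j 0)) w = 'D_1 h (w i 0).
Proof.
apply: eq_increment_derive => t.
rewrite -sumrB (bigD1 i)//= big1 ?addr0 => [|j ji]; first by rewrite !mxE !eqxx.
by rewrite !mxE (negbTE ji) /= mulr0 add0r subrr.
Qed.

(** Differentiation in [w] keeps the form [Gfun] with the same weights, so [Gfun_cvg] also serves
    for the gradient and the Hessian of [G]. *)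
Lemma partial_Gfun r (g : 'cV[R]_n -> R) (Rs : 'I_r -> 'cV[R]_n -> R) lb i :
  (forall w, differentiable g w) -> (forall k w, differentiable (Rs k) w) ->
  partial i (Gfun g Rs lb) = Gfun (partial i g) (fun k => partial i (Rs k)) lb.
Proof.
move=> dg dR; apply/funext => w.
have -> : Gfun g Rs lb = g + \sum_k (lb k 0 \*: Rs k).
  by apply/funext => v; rewrite fct_sumE.
apply: derive_val; apply: is_deriveD; first exact/derivableP/diff_derivable.
apply: is_derive_sum => k; apply: is_deriveZ.
exact/derivableP/diff_derivable.
Qed.

Lemma hess_Gfun r (g : 'cV[R]_n -> R) (Rs : 'I_r -> 'cV[R]_n -> R) lb w i j :
  C2 g -> (forall k, C2 (Rs k)) ->
  hess (Gfun g Rs lb) w i j =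
  Gfun (partial j (partial i g)) (fun k => partial j (partial i (Rs k))) lb w.
Proof.
move=> [[g1 _] g2] R2; rewrite mxE partial_Gfun => [|//|k v]; last by case: (R2 k) => -[].
rewrite partial_Gfun// => [v|k v]; first by case: (g2 i).
by case: (R2 k) => _ /(_ i)[].
Qed.

End VectorCalculus.

(** * Limits along a filter *)

Section Limits.
Context {R : realType} {T : Type} {F : set_system T} {FF : ProperFilter F}.

Lemma cvg_sum {I : finType} (P : pred I) (h : I -> T -> R) (l : I -> R) :
  (forall i, P i -> h i @ F --> l i) ->
  (\sum_(i | P i) h i t) @[t --> F] --> \sum_(i | P i) l i.
Proof. by move=> H; apply: cvg_big => //; exact: add_continuous. Qed.

Lemma cvg_coord {q s : nat} (A : T -> 'M[R]_(q, s)) (B : 'M[R]_(q, s)) i j :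
  A @ F --> B -> A t i j @[t --> F] --> B i j.
Proof.
move=> AB; pose c M : R := (M : 'M[R]_(q, s)) i j.
exact: (cvg_comp A c AB (@coord_continuous _ _ _ i j B)).
Qed.

Lemma Gfun_cvg {n r : nat} (g : 'cV[R]_n -> R) (Rs : 'I_r -> 'cV[R]_n -> R)
    (lam : T -> 'cV[R]_r.+1) (w : T -> 'cV[R]_n) (lam0 : 'cV[R]_r.+1) (w0 : 'cV[R]_n) :
  continuous g -> (forall k, continuous (Rs k)) ->
  lam @ F --> lam0 -> w @ F --> w0 ->
  Gfun g Rs (lbar (lam t)) (w t) @[t --> F] --> Gfun g Rs (lbar lam0) w0.
Proof.
move=> cg cR lc wc; apply: cvgD; first exact: (cvg_comp _ _ wc (cg w0)).
apply: cvg_sum => k _; apply: cvgM; last exact: (cvg_comp _ _ wc (cR k w0)).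
by rewrite mxE; under eq_fun do rewrite mxE; exact: cvg_coord.
Qed.

Lemma cvg0_of_le (h e : T -> R) :
  (\forall t \near F, `|h t| <= e t) -> e @ F --> 0 -> h @ F --> 0.
Proof.
move=> he e0; apply/norm_cvg0P; apply: (squeeze_cvgr _ (cvg_cst 0) e0).
by apply: filterS he => t ->; rewrite normr_ge0.
Qed.

End Limits.

(** The filter stands in for a convergent subsequence. It is generated by the tails and the
    preimages under [z] of the neighbourhoods of [x]; that these always meet is the cluster
    property, which makes the filter proper. *)
Lemma cluster_filter {U : topologicalType} (z : nat -> U) (x : U) :
  cluster (z @ \oo) x ->
  exists F : set_system nat, [/\ ProperFilter F, F `=>` \oo & z @ F --> x].
Proof.
move=> zx; pose F := [set A : set nat | exists2 B, nbhs x B &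
  \forall k \near \oo, B (z k) -> A k].
exists F; split.
- apply: Build_ProperFilter => [[B xB /= FB]|].
  + have [u [Bu]] := zx _ _ (FB : (z @ \oo) (~` B)) xB.
    by [].
  + split.
    * by exists setT; [exact: filterT|exact: nearW].
    * move=> P Q [B xB BP] [C xC CQ]; exists (B `&` C); first exact: filterI.
      by apply: filterS2 BP CQ => k BP CQ [/BP ? /CQ ?].
    * by move=> P Q PQ [B xB BP]; exists B => //; apply: filterS BP => k BP /BP/PQ.
- by move=> A oA; exists setT; [exact: filterT|apply: filterS oA].
- by move=> A xA; exists A => //; exact: nearW.
Qed.

(** * Componentwise residuals of an approximate KKT point *)

Section ApproxKKT.
Context {R : realType} {n r : nat}.
Variables (f g : 'cV[R]_n -> R) (Rs : 'I_r -> 'cV[R]_n -> R).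
Variables (p eps : R) (psi rho : R -> R).

Lemma norm_entry_le_dotv q (v : 'cV[R]_q) i : v i 0 ^+ 2 <= dotv v v.
Proof.
rewrite /dotv (bigD1 i)//= -expr2 lerDl sumr_ge0// => j _.
by rewrite -expr2 sqr_ge0.
Qed.

Lemma dotv_ge0 q (v : 'cV[R]_q) : 0 <= dotv v v.
Proof. by apply: sumr_ge0 => i _; rewrite -expr2 sqr_ge0. Qed.

(** The square of each scalar residual is one of the nonnegative summands under the root, so its
    absolute value is at most the Euclidean norm of the whole residual. *)
Lemma approx_KKT_residuals mu e (w zeta : 'cV[R]_n) (lam eta : 'cV[R]_r.+1) :
  approx_KKT f g Rs p eps psi rho mu e (w, lam, zeta, eta) ->
  let G := Gfun g Rs (lbar lam) in
  let V := varphi psi rho p mu : 'cV[R]_n -> R in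
  [/\ forall i, `|partial i f w
        + \sum_j (hess G w i j + lam 0 0 * hess V w i j) * zeta j 0| <= e,
      `|\sum_i partial i V w * zeta i 0 - eta 0 0| <= e,
      forall k, `|\sum_i partial i (Rs k) w * zeta i 0 - eta (lift ord0 k) 0| <= e,
      forall i, `|partial i G w + lam 0 0 * partial i V w| <= e
    & [/\ forall i, 0 <= (lam - eps *: delta_mx ord0 0) i 0,
          forall i, 0 <= eta i 0
        & `|dotv (lam - eps *: delta_mx ord0 0) eta| <= e]].
Proof.
move=> [d1 [d2 [d3 [d4 [d5 [H e1 e2 e3 [e4 l0 eta0 e5]]]]]]] G V.
have s1 := dotv_ge0 d1; have s3 := dotv_ge0 d3; have s4 := dotv_ge0 d4.
have s2 := sqr_ge0 d2; have s5 := sqr_ge0 d5.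
have key x : x ^+ 2 <= dotv d1 d1 + d2 ^+ 2 + dotv d3 d3 + dotv d4 d4 + d5 ^+ 2 ->
    `|x| <= e.
  by move=> xs; apply: le_trans H; rewrite -sqrtr_sqr ler_wsqrtr.
split=> [i||k|i|].
- have -> : partial i f w + \sum_j (hess G w i j + lam 0 0 * hess V w i j) * zeta j 0
    = d1 i 0.
    rewrite -e1 [RHS]mxE; congr (_ + _); first by rewrite mxE.
    rewrite [RHS]mxE; apply: eq_bigr => j _.
    by congr (_ * _); rewrite [RHS]mxE; congr (_ + _); rewrite [RHS]mxE.
  by apply: key; have := norm_entry_le_dotv d1 i; lra.
- have -> : \sum_i partial i V w * zeta i 0 - eta 0 0 = d2.
    rewrite -e2 /dotv; congr (_ - _); apply: eq_bigr => j _.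
    by rewrite mxE.
  by apply: key; lra.
- have -> : \sum_i partial i (Rs k) w * zeta i 0 - eta (lift ord0 k) 0 = d3 k 0.
    rewrite -e3 /dotv; congr (_ - _); apply: eq_bigr => j _.
    by rewrite mxE.
  by apply: key; have := norm_entry_le_dotv d3 k; lra.
- have -> : partial i G w + lam 0 0 * partial i V w = d4 i 0.
    by rewrite -e4 !mxE.
  by apply: key; have := norm_entry_le_dotv d4 i; lra.
split=> //; rewrite e5; apply: key; lra.
Qed.

End ApproxKKT.

(** * The smoothed absolute value and its derivatives *)

Section Density.
Context {R : realType}.
Local Notation leb := (@lebesgue_measure R).
Variable rho : R -> R.
Hypotheses (rho_density : is_density rho) (rho_moment : finite_first_moment rho).
Hypotheses (rho_even : forall x, rho x = rho (- x)) (rho_cont : continuous rho).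

Let rho_ge0 x : 0 <= rho x. Proof. by case: rho_density. Qed.
Let rho_meas : measurable_fun setT rho. Proof. by case: rho_density. Qed.

Lemma integrable_density : leb.-integrable setT (EFin \o rho).
Proof.
case: rho_density => _ _ rho1; apply/integrableP; split.
  exact/measurable_EFinP.
under eq_integral do rewrite /= ger0_norm//.
by rewrite rho1 ltry.
Qed.

Lemma integrable_dist x : leb.-integrable setT (fun t => (`|x - t| * rho t)%:E).
Proof.
have mn y : measurable_fun setT (fun t : R => `|y - t|).
  by apply: measurableT_comp => //; exact: measurable_funB.
have i1 : leb.-integrable setT (fun t => (`|t| * rho t)%:E).
  apply/integrableP; split.
    apply/measurable_EFinP; apply: measurable_funM => //.
  under eq_integral do rewrite /= ger0_norm ?mulr_ge0//.
  exact: rho_moment.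
have i2 : leb.-integrable setT (fun t => (`|x| * rho t + `|t| * rho t)%:E).
  under eq_fun do rewrite EFinD.
  apply: integrableD => //.
  under eq_fun do rewrite EFinM.
  by apply: integrableZl => //; exact: integrable_density.
apply: (le_integrable _ _ _ i2) => //.
  apply/measurable_EFinP; apply: measurable_funM; first exact: mn.
  exact: rho_meas.
move=> t _; rewrite /= lee_fin -mulrDl !normrM (ger0_norm (rho_ge0 t)) normr_id.
by rewrite ler_wpM2r// ger0_norm ?addr_ge0// ler_normB.
Qed.

Definition cdf_of (x : R) : R := \int[leb]_(t in `]-oo, x]) rho t.

Definition smooth_sgn (x : R) : R := 2 * cdf_of x - 1.

Definition smooth_abs (x : R) : R := \int[leb]_t (`|x - t| * rho t).

(** The substitution [t / mu] and the homogeneity of the absolute value reduce every [mu] to the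
    case [mu = 1]. *)
Lemma phi_smooth_abs mu x : 0 < mu -> phi rho mu x = mu * smooth_abs (x / mu).
Proof.
move=> mu0; rewrite /smooth_abs -RintegralZl//; last exact: integrable_dist.
have dF : derive1 (fun t : R => t / mu) = cst mu^-1.
  apply/funext => t; rewrite derive1E; apply: derive_val; exact: is_derive_mulr.
rewrite /phi /Rintegral; congr fine.
have cG : continuous (fun t => mu * (`|x / mu - t| * rho t)).
  move=> t; apply: cvgM; first exact: cvg_cst.
  apply: cvgM; last exact: rho_cont.
  by apply: cvg_norm; apply: cvgB; [exact: cvg_cst|exact: cvg_id].
rewrite (@increasing_ge0_integration_by_substitutionT _ (fun t => t / mu)
   (fun t => mu * (`|x / mu - t| * rho t))) //.
- rewrite dF; apply: eq_integral => t _; congr EFin.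
  rewrite -[RHS]/(mu * (`|x / mu - t / mu| * rho (t / mu)) / mu).
  rewrite -mulrBl normrM (gtr0_norm (x := mu^-1)) ?invr_gt0//.
  by field; exact: lt0r_neq0.
- by move=> a b ab; rewrite ltr_pM2r ?invr_gt0.
- rewrite dF => t; exact: cvg_cst.
- rewrite dF; exact: is_cvg_cst.
- rewrite dF; exact: is_cvg_cst.
- apply: gt0_cvgMlNy => //; first by rewrite invr_gt0.
- apply: gt0_cvgMly => //; by rewrite invr_gt0.
- by move=> t; rewrite !mulr_ge0// ltW.
Qed.

(** [smooth_sgn x] is the mean of the sign of [x - t], taken as [1] for [t <= x] and [-1] otherwise.
    For each [t] this sign is a subgradient of the absolute value at [x - t], and the inequality is
    integrated against [rho]. *)
Lemma smooth_abs_subgradient x y :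
  smooth_sgn x * (y - x) <= smooth_abs y - smooth_abs x.
Proof.
have ir := integrable_density.
have mI : measurable (`]-oo, x]%classic : set R) by exact: measurable_itv.
have ip : leb.-integrable setT (EFin \o (rho \_ `]-oo, x])).
  rewrite -restrict_EFin -integrable_mkcond//.
  exact: integrableS ir.
have i2 : leb.-integrable setT (fun t => (2 * (rho \_ `]-oo, x]) t)%:E).
  by under eq_fun do rewrite EFinM; exact: integrableZl.
have i3 : leb.-integrable setT (fun t => (2 * (rho \_ `]-oo, x]) t - rho t)%:E).
  by under eq_fun do rewrite EFinB; exact: integrableB.
have -> : smooth_sgn x = \int[leb]_t (2 * (rho \_ `]-oo, x]) t - rho t).
  rewrite RintegralB// RintegralZl//; congr (_ * _ - _).
    by rewrite /cdf_of Rintegral_mkcond.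
  by case: rho_density => _ _; rewrite /Rintegral => ->.
rewrite -RintegralZr// -RintegralB//; try exact: integrable_dist.
apply: le_Rintegral => //.
- exact: (integrableZr measurableT (y - x) i3).
- exact: (integrableB measurableT (integrable_dist y) (integrable_dist x)).
move=> t _; rewrite -mulrBl patchE mem_setE in_itv /=.
have r0 := rho_ge0 t.
have yt : y - t <= `|y - t| by exact: ler_norm.
have ty : t - y <= `|y - t| by rewrite distrC ler_norm.
case: (leP t x) => xt.
  by rewrite (ger0_norm (x := x - t)) ?subr_ge0//; nra.
rewrite (ltr0_norm (x := x - t)) ?subr_lt0//.
(* Outside its set a restricted function takes the default value [point], which is [0] in [R]. *)
by rewrite (_ : point = 0)//; nra.
Qed.

Lemma is_derive_cdf_of (x : R) : is_derive x 1 cdf_of (rho x).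
Proof.
(* The fundamental theorem of calculus is applied on a half-line ending at [x + 1], so that [x] is
   interior. *)
have xu : x < x + 1 by rewrite ltrDl.
have i : leb.-integrable [set` Interval -oo%O (BRight (x + 1))] (EFin \o rho).
  exact: integrableS integrable_density.
have [d v] := continuous_FTC1 xu i (ltNyr x) (@rho_cont x).
by rewrite -v derive1E; exact: derivableP.
Qed.

Lemma is_derive_smooth_sgn (x : R) : is_derive x 1 smooth_sgn (2 * rho x).
Proof.
rewrite -[2 * rho x]subr0.
have := is_derive_cdf_of x => d.
exact: (is_deriveB (f := 2 \*: cdf_of) (g := cst 1)).
Qed.

Lemma continuous_smooth_sgn : continuous smooth_sgn.
Proof.
move=> x; apply/differentiable_continuous/derivable1_diffP.
by have [] := is_derive_smooth_sgn x.
Qed.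

Lemma smooth_sgn_MVT x y : x < y ->
  exists2 c, c \in `]x, y[ & smooth_sgn y - smooth_sgn x = 2 * rho c * (y - x).
Proof.
move=> xy; apply: (MVT (df := fun c => 2 * rho c)) => //.
  by move=> c _; exact: is_derive_smooth_sgn.
by apply: continuous_subspaceT; exact: continuous_smooth_sgn.
Qed.

Lemma smooth_sgn_ndecr x y : x <= y -> smooth_sgn x <= smooth_sgn y.
Proof.
rewrite le_eqVlt => /predU1P[->//|xy].
have [c _ e] := smooth_sgn_MVT xy.
by rewrite -subr_ge0 e !mulr_ge0// subr_ge0 ltW.
Qed.

Lemma cdf_of_itv x : 0 <= cdf_of x <= 1.
Proof.
have [_ _ r1] := rho_density.
rewrite Rintegral_ge0//= -(_ : \int[leb]_t rho t = 1); last by rewrite /Rintegral r1.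
rewrite /cdf_of Rintegral_mkcond.
apply: le_Rintegral => //.
- rewrite -restrict_EFin -integrable_mkcond//; exact: integrableS integrable_density.
- exact: integrable_density.
- by move=> t _; rewrite patchE; case: ifP.
Qed.

(** The derivative of the left side is [rho x - rho (- x)], which vanishes by evenness, so the sum
    is constant. *)
Lemma cdf_of_refl x : cdf_of x + cdf_of (- x) = 2 * cdf_of 0.
Proof.
have dn (z : R) : is_derive z 1 (cdf_of \o -%R) (- rho (- z)).
  by rewrite -mulrN1; apply: is_derive1_comp; exact: is_derive_cdf_of.
rewrite mulr_natl mulr2n -[X in _ = _ + cdf_of X]oppr0.
apply: (is_derive_0_is_cst (f := fun z => cdf_of z + cdf_of (- z))) => z.
rewrite -(subrr (rho z)) [X in _ - X]rho_even.
by apply: (is_deriveD (g := cdf_of \o -%R)); exact: is_derive_cdf_of.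
Qed.

(** * Consequences of monotonicity and of the tail bound *)

Hypothesis rho_noninc : forall x y : R, 0 <= x -> x <= y -> rho y <= rho x.
Hypothesis rho_tail : exists c q : R, [/\ 0 < c, 0 < q & forall s : R, 0 <= s ->
  1 - c / (s `^ q + c) <= 2 * \int[leb]_(x in `[0, s]) rho x].

Lemma cdf_of_tail (e : R) : 0 < e ->
  exists2 T, 0 <= T & forall s, T <= s -> 1 - e <= 2 * (cdf_of s - cdf_of 0).
Proof.
move=> e0; have [c [q [c0 q0 H]]] := rho_tail.
(* At this threshold the [q]-th power equals [c / e]; beyond it [c / (s^q + c) <= c / s^q <= e]. *)
exists ((c / e) `^ q^-1); first exact: powR_ge0.
move=> s Ts; have s0 : 0 <= s by apply: le_trans Ts; exact: powR_ge0.
have ir : leb.-integrable [set` Interval -oo%O (BRight s)] (EFin \o rho).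
  exact: integrableS integrable_density.
rewrite /cdf_of Rintegral_itvB// Rintegral_itv_obnd_cbnd; last first.
  exact: integrableS integrable_density.
apply: le_trans (H s s0); rewrite lerB// ler_pdivrMr ?ltr_wpDl ?powR_ge0//.
have ce : 0 <= c / e by rewrite divr_ge0// ltW.
have : c / e <= s `^ q.
  have {1}-> : c / e = ((c / e) `^ q^-1) `^ q.
    by rewrite -powRrM mulVf ?gt_eqF// powRr1.
  by apply: ge0_ler_powR; rewrite ?nnegrE ?powR_ge0// ltW.
rewrite ler_pdivrMr// => sq; nra.
Qed.

(** With [K] for [cdf_of], the tail bound makes [2 (K T - K 0)] at least [1 - e]. The upper bound on
    [K 0] then uses [K T <= 1]; the lower one uses [K T <= 2 K 0], a consequence of the reflection
    identity and [K (- T) >= 0]. *)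
Lemma cdf_of0 : 2 * cdf_of 0 = 1.
Proof.
apply/eqP; rewrite eq_le; apply/andP; split; apply/ler_addgt0Pr => e e0.
  have [T _ /(_ T (lexx T))] := cdf_of_tail e0.
  by have := cdf_of_itv T; lra.
have [T _ /(_ T (lexx T))] := cdf_of_tail e0.
by have := cdf_of_itv (- T); have := cdf_of_refl T; lra.
Qed.

Lemma smooth_sgn_odd x : smooth_sgn (- x) = - smooth_sgn x.
Proof. by rewrite /smooth_sgn; have := cdf_of0; have := cdf_of_refl x; lra. Qed.

Lemma smooth_sgn0 : smooth_sgn 0 = 0.
Proof. by rewrite /smooth_sgn cdf_of0 subrr. Qed.

Lemma norm_smooth_sgn_le1 x : `|smooth_sgn x| <= 1.
Proof. by rewrite ler_norml /smooth_sgn; have := cdf_of_itv x; lra. Qed.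

Lemma smooth_sgn_tail (e : R) : 0 < e ->
  exists2 T, 0 <= T & forall s, T <= s -> 1 - e <= smooth_sgn s.
Proof.
move=> /cdf_of_tail[T T0 H]; exists T => // s /H.
by rewrite /smooth_sgn mulrBr cdf_of0.
Qed.

Lemma norm_smooth_sgn x : `|smooth_sgn x| = smooth_sgn `|x|.
Proof.
have [x0|x0] := leP 0 x.
  by rewrite (ger0_norm x0) ger0_norm// -smooth_sgn0 smooth_sgn_ndecr.
rewrite (ltr0_norm x0) smooth_sgn_odd ler0_norm// -smooth_sgn0.
by rewrite smooth_sgn_ndecr// ltW.
Qed.

(** Since [rho] is nonincreasing, [smooth_sgn] grows by at least [s * rho s] on the interval from
    [s / 2] to [s], and it never exceeds [1]. *)
Lemma density_decay s : 0 < s -> s * rho s <= 1 - smooth_sgn (s / 2).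
Proof.
move=> s0; have s2 : s / 2 < s by rewrite ltr_pdivrMr// ltr_pMr// ltr1n.
have [c] := smooth_sgn_MVT s2; rewrite in_itv/= => /andP[c1 c2] e.
have rc : rho s <= rho c.
  by apply: rho_noninc; [rewrite ltW// (lt_trans _ c1)// divr_gt0|exact: ltW].
have := norm_smooth_sgn_le1 s; rewrite ler_norml => /andP[_].
have -> : s * rho s = 2 * rho s * (s - s / 2) by field.
have : 2 * rho s * (s - s / 2) <= 2 * rho c * (s - s / 2).
  by apply: ler_wpM2r; [rewrite subr_ge0 ltW|rewrite ler_wpM2l].
lra.
Qed.

(** As [smooth_sgn] is nondecreasing, the strict inequality forces the absolute value of [s] below
    [a]; evenness and monotonicity of [rho] then conclude. *)
Lemma smooth_sgn_lt_density a s : 0 <= a -> `|smooth_sgn s| < smooth_sgn a ->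
  rho a <= rho s.
Proof.
move=> a0; rewrite norm_smooth_sgn => sa.
have -> : rho s = rho `|s|.
  by case: (ger0P s) => // _; exact: rho_even.
apply: rho_noninc => //; rewrite leNgt; apply/negP => as_.
by move: sa; rewrite ltNge smooth_sgn_ndecr// ltW.
Qed.

(** Supplies the point [a] for [smooth_sgn_lt_density]. If [rho] is positive, any large [a] works.
    If [l = 0], the mean value theorem yields [c] with [rho c > 0]; then [rho >= rho c] before [c],
    so [smooth_sgn c > 0]. *)
Lemma density_threshold (l : R) :
    l < 1 -> (forall x, 0 < rho x) \/ l = 0 ->
  exists a, [/\ 0 < a, 0 < rho a & l < smooth_sgn a].
Proof.
move=> l1 [rpos|->].
  have [|T T0 H] := @smooth_sgn_tail ((1 - l) / 2); first by rewrite divr_gt0 ?subr_gt0.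
  exists (T + 1); split=> //; first by rewrite ltr_wpDl.
  by have := H (T + 1); rewrite lerDl ler01 => /(_ isT); lra.
have [|T T0 H] := @smooth_sgn_tail (1 / 2); first by rewrite divr_gt0.
have {H} HT : 0 < smooth_sgn T by have := H T (lexx T); lra.
have T1 : 0 < T.
  by rewrite lt_neqAle T0 andbT; apply/eqP => T00; move: HT; rewrite -T00 smooth_sgn0 ltxx.
have [c] := smooth_sgn_MVT T1; rewrite in_itv/= smooth_sgn0 !subr0 => /andP[c0 c1] e.
have rc : 0 < rho c.
  rewrite lt_neqAle rho_ge0 andbT; apply/eqP => rc.
  by move: HT; rewrite e -rc mulr0 mul0r ltxx.
exists c; split=> //.
have [d] := smooth_sgn_MVT c0; rewrite in_itv/= smooth_sgn0 !subr0 => /andP[d0 dc] ->.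
by rewrite !mulr_gt0// (lt_le_trans rc)// rho_noninc// ltW.
Qed.

(** The subgradient inequalities at [x] and at [y] squeeze the difference quotient between
    [smooth_sgn x] and [smooth_sgn y], and [smooth_sgn] is continuous. The quotient, completed at
    [x], is the Caratheodory slope function. *)
Lemma is_derive_smooth_abs (x : R) : is_derive x 1 smooth_abs (smooth_sgn x).
Proof.
have cS := @continuous_smooth_sgn x.
apply/is_derive1_caratheodory.
exists (fun y => if y == x then smooth_sgn x else (smooth_abs y - smooth_abs x) / (y - x)).
split=> [y||]; last by rewrite eqxx.
  by have [->|yx] := eqVneq y x; rewrite ?subrr ?mulr0// divfK// subr_eq0.
apply/cvgrPdist_le => e e0; rewrite eqxx.
have /cvgrPdist_le/(_ e e0) := cS.
apply: filterS => y; have [->|yx] := eqVneq y x; first by rewrite subrr.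
have := smooth_abs_subgradient x y; have := smooth_abs_subgradient y x.
set d := smooth_abs y - smooth_abs x => H2 H3.
rewrite !ler_norml => /andP[h1 h2].
have [xy|yx'] : x < y \/ y < x by apply/orP; rewrite -neq_lt eq_sym.
  have yx0 : 0 < y - x by rewrite subr_gt0.
  have H4 : smooth_sgn x <= d / (y - x) by rewrite ler_pdivlMr.
  have H5 : d / (y - x) <= smooth_sgn y by rewrite ler_pdivrMr// /d; lra.
  lra.
have yx0 : y - x < 0 by rewrite subr_lt0.
have H4 : d / (y - x) <= smooth_sgn x by rewrite ler_ndivrMr.
have H5 : smooth_sgn y <= d / (y - x) by rewrite ler_ndivlMr// /d; lra.
lra.
Qed.

Lemma smooth_abs0_le x : smooth_abs 0 <= smooth_abs x.
Proof.
by have := smooth_abs_subgradient 0 x; rewrite smooth_sgn0 mul0r subr_ge0.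
Qed.

Lemma smooth_abs_le x : smooth_abs x <= `|x| + smooth_abs 0.
Proof.
have := smooth_abs_subgradient x 0; rewrite sub0r => H.
have : smooth_sgn x * x <= `|x|.
  rewrite (le_trans (ler_norm _))// normrM ler_piMl//.
  exact: norm_smooth_sgn_le1.
lra.
Qed.

Lemma smooth_abs_even x : smooth_abs (- x) = smooth_abs x.
Proof.
have dn (z : R) : is_derive z 1 (smooth_abs \o -%R) (- smooth_sgn (- z)).
  by rewrite -mulrN1; apply: is_derive1_comp; exact: is_derive_smooth_abs.
apply/eqP; rewrite eq_sym -subr_eq0.
rewrite -[0](subrr (smooth_abs 0)) -[X in _ == _ - smooth_abs X]oppr0; apply/eqP.
apply: (is_derive_0_is_cst (f := smooth_abs - (smooth_abs \o -%R))) => z.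
have -> : 0 = smooth_sgn z - - smooth_sgn (- z) :> R.
  by rewrite opprK smooth_sgn_odd subrr.
by apply: is_deriveB; exact: is_derive_smooth_abs.
Qed.

(** The triangle inequality bounds [2 * y] by the sum of the distances from [t] to [y] and to [- y];
    integrating and using evenness of [smooth_abs] gives the claim. *)
Lemma norm_le_smooth_abs x : `|x| <= smooth_abs x.
Proof.
have H (y : R) : 2 * y <= smooth_abs y + smooth_abs (- y).
  have i1 : leb.-integrable setT (fun t => (rho t)%:E) := integrable_density.
  rewrite -RintegralD//; try exact: integrable_dist.
  have -> : 2 * y = \int[leb]_t (2 * y * rho t).
    have [_ _ r1] := rho_density.
    by rewrite RintegralZl// /Rintegral r1 mulr1.
  apply: le_Rintegral => //.
  - exact: (integrableZl measurableT (2 * y) i1).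
  - exact: (integrableD measurableT (integrable_dist y) (integrable_dist (- y))).
  move=> t _; rewrite -mulrDl ler_wpM2r//.
  have := ler_norm (y - t); have : y + t <= `|- y - t|; last lra.
  by rewrite -opprD normrN ler_norm.
have := H x; have := H (- x); rewrite opprK smooth_abs_even ler_norml.
lra.
Qed.

Lemma smooth_abs_gt0 : 0 < smooth_abs 0.
Proof.
have r0 := rho_ge0 0.
(* With this [a], [smooth_sgn a <= 2 * rho 0 * a < 1 / 2], so the subgradient inequality at [a]
   gives [smooth_abs 0 >= a * (1 - smooth_sgn a) > 0]. *)
pose a := (4 * rho 0 + 1)^-1.
have a0 : 0 < a by rewrite invr_gt0 ltr_wpDl// mulr_ge0.
have ae : (4 * rho 0 + 1) * a = 1 by rewrite divff// gt_eqF// ltr_wpDl// mulr_ge0.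
have [c] := smooth_sgn_MVT a0; rewrite in_itv/= smooth_sgn0 !subr0 => /andP[c0 _] e.
have rc : rho c <= rho 0 by apply: rho_noninc => //; exact: ltW.
have := smooth_abs_subgradient a 0; rewrite sub0r e.
have := norm_le_smooth_abs a; rewrite gtr0_norm//.
have : 2 * rho c * a <= 2 * rho 0 * a by rewrite ler_pM2r// ler_pM2l.
nra.
Qed.

Lemma is_derive_phi (mu x : R) : 0 < mu ->
  is_derive x 1 (phi rho mu) (smooth_sgn (x / mu)).
Proof.
move=> mu0.
have -> : phi rho mu = mu \*: (smooth_abs \o (fun y : R => y * mu^-1)).
  by apply/funext => y; rewrite phi_smooth_abs.
have -> : smooth_sgn (x / mu) = mu *: (smooth_sgn (x / mu) * mu^-1).
  by rewrite /GRing.scale /= mulrCA divff ?gt_eqF// mulr1.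
apply: is_deriveZ; apply: is_derive1_comp; first exact: is_derive_smooth_abs.
exact: is_derive_mulr.
Qed.

Lemma norm_le_phi (mu x : R) : 0 < mu -> `|x| <= phi rho mu x.
Proof.
move=> mu0; rewrite phi_smooth_abs// -ler_pdivrMl//.
apply: le_trans (norm_le_smooth_abs _).
by rewrite normrM (gtr0_norm (x := mu^-1)) ?invr_gt0// mulrC.
Qed.

Lemma phi_le (mu x : R) : 0 < mu -> phi rho mu x <= `|x| + mu * smooth_abs 0.
Proof.
move=> mu0; rewrite phi_smooth_abs// -ler_pdivlMl//.
apply: le_trans (smooth_abs_le _) _.
rewrite normrM (gtr0_norm (x := mu^-1)) ?invr_gt0// mulrDr mulKf ?gt_eqF//.
by rewrite mulrC.
Qed.

Lemma phi_ge (mu x : R) : 0 < mu -> mu * smooth_abs 0 <= phi rho mu x.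
Proof. by move=> mu0; rewrite phi_smooth_abs// ler_pM2l// smooth_abs0_le. Qed.

Lemma phi_gt0 (mu x : R) : 0 < mu -> 0 < phi rho mu x.
Proof.
by move=> mu0; apply: lt_le_trans (phi_ge _ mu0); rewrite mulr_gt0// smooth_abs_gt0.
Qed.

(** * The smoothed penalty in one variable and its two derivatives *)

Variables (psi : R -> R) (p : R).
Hypothesis psi_C2 : C2_nneg psi.

Local Notation psi' := (deriv_nneg psi).
Local Notation psi'' := (deriv_nneg (deriv_nneg psi)).
Local Notation u := (phi rho).

Definition dsmooth_pen (mu x : R) : R :=
  psi' (u mu x `^ p) * (p * u mu x `^ (p - 1) * smooth_sgn (x / mu)).

Definition ddsmooth_pen (mu x : R) : R :=
  psi'' (u mu x `^ p) * (p * u mu x `^ (p - 1) * smooth_sgn (x / mu)) ^+ 2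
  + psi' (u mu x `^ p)
    * (p * (p - 1) * u mu x `^ (p - 2) * smooth_sgn (x / mu) ^+ 2
       + p * u mu x `^ (p - 1) * (2 * rho (x / mu) / mu)).

Let is_derive_u_powR (mu x a : R) : 0 < mu ->
  is_derive x 1 (fun y => u mu y `^ a) (a * u mu x `^ (a - 1) * smooth_sgn (x / mu)).
Proof.
move=> mu0; have d1 := is_derive_phi x mu0.
have d2 := is_derive1_powR a (phi_gt0 x mu0).
exact: (is_derive1_comp d2 d1).
Qed.

Lemma is_derive_smooth_pen (mu x : R) : 0 < mu ->
  is_derive x 1 (fun y => psi (u mu y `^ p)) (dsmooth_pen mu x).
Proof.
move=> mu0; have [[d _] _] := psi_C2.
have u0 : 0 < u mu x `^ p by rewrite powR_gt0// phi_gt0.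
have d1 := is_derive_nneg u0 (d _ (ltW u0)).
exact: (is_derive1_comp (g := fun y => u mu y `^ p) d1 (is_derive_u_powR x p mu0)).
Qed.

Lemma is_derive_dsmooth_pen (mu x : R) : 0 < mu ->
  is_derive x 1 (dsmooth_pen mu) (ddsmooth_pen mu x).
Proof.
move=> mu0; have [_ [d _]] := psi_C2.
have u0 : 0 < u mu x `^ p by rewrite powR_gt0// phi_gt0.
have d1 := is_derive1_comp (g := fun y => u mu y `^ p) (is_derive_nneg u0 (d _ (ltW u0)))
  (is_derive_u_powR x p mu0).
have d2 := is_derive_u_powR x (p - 1) mu0.
have d3 : is_derive x 1 (fun y => smooth_sgn (y / mu)) (2 * rho (x / mu) / mu).
  by apply: is_derive1_comp; [exact: is_derive_smooth_sgn|exact: is_derive_mulr].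
have d4 := is_deriveM (is_deriveZ p d2) d3.
have d5 := is_deriveM d1 d4.
have -> : ddsmooth_pen mu x =
   (psi' \o (fun y => u mu y `^ p)) x *:
      ((p *: (u mu x `^ (p - 1))) *: (2 * rho (x / mu) / mu)
       + smooth_sgn (x / mu) *: (p *: ((p - 1) * u mu x `^ (p - 1 - 1) * smooth_sgn (x / mu))))
   + ((p *: (u mu x `^ (p - 1))) * smooth_sgn (x / mu)) *:
     (psi'' (u mu x `^ p) * (p * u mu x `^ (p - 1) * smooth_sgn (x / mu))).
  rewrite /ddsmooth_pen /GRing.scale /=.
  by rewrite (_ : p - 1 - 1 = p - 2); ring.
exact: d5.
Qed.

(** * Behaviour of the smoothed sign and of the density at infinity *)

Lemma smooth_sgn_cvgy : smooth_sgn s @[s --> +oo] --> (1 : R).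
Proof.
apply/cvgrPdist_le => e e0; have [t _ H] := smooth_sgn_tail e0.
near=> s; have := norm_smooth_sgn_le1 s; rewrite !ler_norml => /andP[_ s1].
have : 1 - e <= smooth_sgn s by apply: H; near: s; apply: nbhs_pinfty_ge; exact: num_real.
by move: s1 e0; lra.
Unshelve. all: end_near. Qed.

Lemma density_decay_cvgy : s * rho s @[s --> +oo] --> (0 : R).
Proof.
have half : (s : R) / 2 @[s --> +oo] --> +oo.
  by apply: gt0_cvgMly => //; rewrite invr_gt0.
have H : (1 - smooth_sgn (s / 2)) @[s --> +oo] --> (0 : R).
  rewrite -(subrr 1); apply: cvgB; first exact: cvg_cst.
  exact: (cvg_comp _ _ half smooth_sgn_cvgy).
apply: (squeeze_cvgr _ (cvg_cst 0) H).
near=> s; have s0 : 0 < s by near: s; apply: nbhs_pinfty_gt; exact: num_real.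
by rewrite mulr_ge0 ?(ltW s0)//= density_decay.
Unshelve. all: end_near. Qed.

Lemma smooth_sgnE (s : R) : smooth_sgn s = Num.sg s * smooth_sgn `|s|.
Proof.
case: (sgrP s) => [->|s0|s0]; first by rewrite mul0r smooth_sgn0.
  by rewrite mul1r.
by rewrite mulN1r smooth_sgn_odd opprK.
Qed.

(** * Limits of the smoothed penalty as the smoothing parameter vanishes *)

Section Limits.
Context {T : Type} {F : set_system T} {FF : ProperFilter F}.
Variables (m x : T -> R) (x0 : R).
Hypotheses (m_gt0 : \forall t \near F, 0 < m t) (m_cvg : m @ F --> 0).
Hypothesis x_cvg : x @ F --> x0.

Lemma phi_cvg : u (m t) (x t) @[t --> F] --> `|x0|.
Proof.
have H1 : `|x t| @[t --> F] --> `|x0| by exact: cvg_norm.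
have H2 : `|x t| + m t * smooth_abs 0 @[t --> F] --> `|x0|.
  have -> : `|x0| = `|x0| + 0 * smooth_abs 0 by rewrite mul0r addr0.
  apply: cvgD; first exact: H1.
  by apply: cvgM; [exact: m_cvg|exact: cvg_cst].
apply: (squeeze_cvgr _ H1 H2).
by apply: filterS m_gt0 => t t0; rewrite norm_le_phi// phi_le.
Qed.

Hypothesis p_gt0 : 0 < p.

Let u_ge0 : \forall t \near F, 0 <= u (m t) (x t).
Proof. by apply: filterS m_gt0 => t t0; exact/ltW/phi_gt0. Qed.

Let up_ge0 : \forall t \near F, 0 <= u (m t) (x t) `^ p.
Proof. by apply: filterS m_gt0 => t t0; exact: powR_ge0. Qed.

Let up_cvg : u (m t) (x t) `^ p @[t --> F] --> `|x0| `^ p.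
Proof.
have [x00|x00] := eqVneq x0 0.
  have := phi_cvg; rewrite x00 normr0 powR0 ?gt_eqF// => uc.
  exact: (cvg_powR0 p_gt0 u_ge0 uc).
by apply: cvg_powR; [rewrite normr_gt0|exact: phi_cvg].
Qed.

Lemma deriv_psi_cvg : psi' (u (m t) (x t) `^ p) @[t --> F] --> psi' (`|x0| `^ p).
Proof.
apply: (cvg_within_nneg _ up_ge0 (powR_ge0 _ _) up_cvg).
by have [[]] := psi_C2.
Qed.

Lemma deriv2_psi_cvg : psi'' (u (m t) (x t) `^ p) @[t --> F] --> psi'' (`|x0| `^ p).
Proof.
apply: (cvg_within_nneg _ up_ge0 (powR_ge0 _ _) up_cvg).
by have [_ []] := psi_C2.
Qed.

(** * Coordinates with a nonzero limit *)

Section Nonzero.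
Hypothesis x0_neq0 : x0 != 0.

Let nx_gt0 : 0 < `|x0|. Proof. by rewrite normr_gt0. Qed.

Let near_far : \forall t \near F, `|x0| / 2 <= `|x t|.
Proof.
have /cvgrPdist_le/(_ (`|x0| / 2)) : `|x t| @[t --> F] --> `|x0| by exact: cvg_norm.
move=> /(_ (divr_gt0 nx_gt0 (ltr0n _ 2))); apply: filterS => t.
by rewrite ler_norml => /andP[_]; lra.
Qed.

Let ratio_cvgy : `|x t / m t| @[t --> F] --> +oo.
Proof.
apply/cvgryPge => A.
(* Once [m t] is below this value, the ratio is at least the absolute value of [A] plus [1]; adding
   [1] avoids a zero divisor. *)
have d0 : 0 < `|x0| / 2 / (`|A| + 1) by rewrite !divr_gt0// ltr_wpDl.
have /cvgrPdist_le/(_ _ d0) := m_cvg; apply: filterS3 m_gt0 near_far => t t0 xt.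
rewrite sub0r normrN (gtr0_norm t0) normrM (gtr0_norm (x := _^-1)) ?invr_gt0//.
rewrite ler_pdivlMr ?ltr_wpDl// [A <= _]ler_pdivlMr// => H.
have := ler_norm A; nra.
Qed.

Lemma smooth_sgn_cvg : smooth_sgn (x t / m t) @[t --> F] --> Num.sg x0.
Proof.
have H : Num.sg x0 * smooth_sgn `|x t / m t| @[t --> F] --> Num.sg x0 * 1.
  by apply: cvgM; [exact: cvg_cst|exact: (cvg_comp _ _ ratio_cvgy smooth_sgn_cvgy)].
rewrite mulr1 in H; apply: cvg_trans H; apply: near_eq_cvg.
have /cvgrPdist_lt/(_ _ nx_gt0) := x_cvg; apply: filterS2 m_gt0 => t t0 H.
rewrite [RHS]smooth_sgnE sgrM (gtr0_sg (x := _^-1)) ?invr_gt0// mulr1; congr (_ * _).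
move: H; move: x0_neq0; rewrite ltr_norml neq_lt => /orP[x00|x00].
  rewrite (ltr0_norm x00) (ltr0_sg x00) => H.
  by rewrite ltr0_sg//; lra.
rewrite (gtr0_norm x00) (gtr0_sg x00) => H.
by rewrite gtr0_sg//; lra.
Qed.

(** With [s] the absolute value of [x / m], [rho (x / m) / m] is [s * rho s] divided by the absolute
    value of [x]. The numerator tends to [0] and the denominator stays away from it. *)
Lemma density_cvg0 : 2 * rho (x t / m t) / m t @[t --> F] --> 0.
Proof.
have H : 2 * (`|x t / m t| * rho `|x t / m t|) * `|x t|^-1 @[t --> F] --> 2 * 0 * `|x0|^-1.
  apply: cvgM; last by apply: cvgV; [rewrite gt_eqF|exact: cvg_norm].
  apply: cvgM; first exact: cvg_cst.
  exact: (cvg_comp _ _ ratio_cvgy density_decay_cvgy).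
rewrite mulr0 mul0r in H; apply: cvg_trans H; apply: near_eq_cvg.
apply: filterS2 m_gt0 near_far => t t0 xt.
have xt0 : 0 < `|x t| by apply: lt_le_trans xt; rewrite divr_gt0.
have -> : rho `|x t / m t| = rho (x t / m t) by case: (ger0P (x t / m t)).
rewrite normrM (gtr0_norm (x := _^-1)) ?invr_gt0//.
by field; rewrite !gt_eqF.
Qed.

Let ua_cvg a : u (m t) (x t) `^ a @[t --> F] --> `|x0| `^ a.
Proof. by apply: cvg_powR => //; exact: phi_cvg. Qed.

Lemma dsmooth_pen_cvg : dsmooth_pen (m t) (x t) @[t --> F] -->
  psi' (`|x0| `^ p) * (p * `|x0| `^ (p - 1) * Num.sg x0).
Proof.
apply: cvgM; first exact: deriv_psi_cvg.
apply: cvgM; last exact: smooth_sgn_cvg.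
by apply: cvgM; [exact: cvg_cst|exact: ua_cvg].
Qed.

Lemma ddsmooth_pen_cvg : ddsmooth_pen (m t) (x t) @[t --> F] -->
  p * (p - 1) * `|x0| `^ (p - 2) * psi' (`|x0| `^ p)
  + p ^+ 2 * `|x0| `^ (2 * p - 2) * psi'' (`|x0| `^ p).
Proof.
have sg2 : Num.sg x0 ^+ 2 = 1 by rewrite sqr_sg x0_neq0.
have -> : p * (p - 1) * `|x0| `^ (p - 2) * psi' (`|x0| `^ p)
    + p ^+ 2 * `|x0| `^ (2 * p - 2) * psi'' (`|x0| `^ p) =
  psi'' (`|x0| `^ p) * (p * `|x0| `^ (p - 1) * Num.sg x0) ^+ 2
  + psi' (`|x0| `^ p)
    * (p * (p - 1) * `|x0| `^ (p - 2) * Num.sg x0 ^+ 2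
       + p * `|x0| `^ (p - 1) * 0).
  have -> : `|x0| `^ (2 * p - 2) = (`|x0| `^ (p - 1)) ^+ 2.
    by rewrite -powR_mulrn ?powR_ge0// -powRrM; congr (_ `^ _); ring.
  by rewrite exprMn sg2; ring.
have c1 : p * u (m t) (x t) `^ (p - 1) @[t --> F] --> p * `|x0| `^ (p - 1).
  by apply: cvgM; [exact: cvg_cst|exact: ua_cvg].
apply: cvgD; apply: cvgM.
- exact: deriv2_psi_cvg.
- have c2 : p * u (m t) (x t) `^ (p - 1) * smooth_sgn (x t / m t) @[t --> F] -->
     p * `|x0| `^ (p - 1) * Num.sg x0 by apply: cvgM; [exact: c1|exact: smooth_sgn_cvg].
  by apply: cvgM.
- exact: deriv_psi_cvg.
apply: cvgD; apply: cvgM; [|..|exact: density_cvg0].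
- by apply: cvgM; [exact: cvg_cst|exact: ua_cvg].
- by apply: cvgM; exact: smooth_sgn_cvg.
- exact: c1.
Qed.

End Nonzero.

(** * Coordinates tending to zero *)

Section Zero.
Variables (l beta : R).
Hypotheses (x0_eq0 : x0 = 0) (p_le1 : p <= 1) (beta_gt0 : 0 < beta).
Hypothesis psi'0_gt0 : 0 < psi' 0.
Hypothesis psi''_ge : forall t : R, 0 <= t -> - beta <= psi'' t.
Hypothesis rho_pos : p = 1 -> forall y, 0 < rho y.
Hypothesis dpen_cvg : dsmooth_pen (m t) (x t) @[t --> F] --> l.
Hypothesis l_lt : p = 1 -> `|l| < psi' 0.

Let u_cvg0 : u (m t) (x t) @[t --> F] --> 0.
Proof. by have := phi_cvg; rewrite x0_eq0 normr0. Qed.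

Let dpsi_cvg : psi' (u (m t) (x t) `^ p) @[t --> F] --> psi' 0.
Proof. by have := deriv_psi_cvg; rewrite x0_eq0 normr0 powR0// gt_eqF. Qed.

Let near_dpsi : \forall t \near F, psi' 0 / 2 <= psi' (u (m t) (x t) `^ p).
Proof.
have /cvgrPdist_le/(_ _ (divr_gt0 psi'0_gt0 (ltr0n _ 2))) := dpsi_cvg.
by apply: filterS => t; rewrite ler_norml => /andP[_]; lra.
Qed.

(* The stationarity residual being bounded forces phi'(x) = O(phi^(1-p)); for
   p < 1 the right-hand side tends to 0, while 0 `^ 0 = 1 covers p = 1. *)
Let sgn_cvg : smooth_sgn (x t / m t) @[t --> F] -->
  l * 0 `^ (1 - p) / (psi' 0 * p).
Proof.
have c1 : u (m t) (x t) `^ (1 - p) @[t --> F] --> 0 `^ (1 - p).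
  have [->|p1] := eqVneq p 1.
    by rewrite subrr powRr0; under eq_fun do rewrite powRr0; exact: cvg_cst.
  rewrite powR0 ?subr_eq0 1?eq_sym//; apply: cvg_powR0 => //.
  by rewrite subr_gt0 lt_neqAle p1.
have H : dsmooth_pen (m t) (x t) * u (m t) (x t) `^ (1 - p) / (psi' (u (m t) (x t) `^ p) * p)
    @[t --> F] --> l * 0 `^ (1 - p) / (psi' 0 * p).
  apply: cvgM; first exact: cvgM.
  apply: cvgV; first by rewrite gt_eqF// mulr_gt0.
  by apply: cvgM; [exact: dpsi_cvg|exact: cvg_cst].
apply: cvg_trans H; apply: near_eq_cvg.
apply: filterS2 m_gt0 near_dpsi => t t0 dp.
have u0 := phi_gt0 (x t) t0.
have dp0 : 0 < psi' (u (m t) (x t) `^ p) by apply: lt_le_trans dp; rewrite divr_gt0.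
rewrite /dsmooth_pen.
have -> : 1 - p = - (p - 1) by ring.
have up : 0 < u (m t) (x t) `^ (p - 1) by rewrite powR_gt0.
by rewrite powRN; field; rewrite !gt_eqF.
Qed.

(** The first two parts are the premises of [density_threshold]; the third makes the concave
    contribution [(1 - p) * smooth_sgn ^ 2] negligible, because either [p = 1] or the limit is
    [0]. *)
Let sgn_lim : `|l * 0 `^ (1 - p) / (psi' 0 * p)| < 1 /\
  ((forall y, 0 < rho y) \/ `|l * 0 `^ (1 - p) / (psi' 0 * p)| = 0) /\
  (1 - p) * (l * 0 `^ (1 - p) / (psi' 0 * p)) ^+ 2 = 0.
Proof.
have [p1|p1] := eqVneq p 1.
  rewrite p1 subrr powRr0 !mulr1 mul0r; split; last first.
    by split=> //; left; exact: rho_pos.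
  rewrite normrM (gtr0_norm (x := _^-1)) ?invr_gt0// ltr_pdivrMr// mul1r.
  exact: l_lt.
rewrite powR0 ?subr_eq0 1?eq_sym// mulr0 mul0r normr0 expr0n mulr0.
by split=> //; split=> //; right.
Qed.

(** Writing [y] for [phi], the factor of [psi'] is [p * y^(p-2) * (2 * y * rho / m - (1 - p) *
    smooth_sgn^2)]. The bracket stays above a positive constant and [y^(p-2)] tends to [+oo], while
    the [psi''] term is bounded below. *)
Lemma ddsmooth_pen_cvgy : ddsmooth_pen (m t) (x t) @[t --> F] --> +oo.
Proof.
have [L1 [Lpos L2]] := sgn_lim; move: sgn_cvg L1 Lpos L2.
set L := l * _ / _ => Sc L1 Lpos L2.
have [a [a0 ra La]] := density_threshold L1 Lpos.
have M0 := smooth_abs_gt0; set M := smooth_abs 0 in M0.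
(* From [phi >= m * M] and the density being at least [rho a], the term [2 * phi * rho / m] is at
   least [2 * d]; one [d] absorbs the concave contribution and one remains. *)
pose d := M * rho a; have d0 : 0 < d by rewrite mulr_gt0.
have nS : \forall t \near F, `|smooth_sgn (x t / m t)| < smooth_sgn a.
  exact: (cvgr_lt _ (cvg_norm Sc) _ La).
have nS2 : \forall t \near F, (1 - p) * smooth_sgn (x t / m t) ^+ 2 <= d.
  have H : (1 - p) * (smooth_sgn (x t / m t) * smooth_sgn (x t / m t)) @[t --> F] --> 0.
    rewrite -[X in _ --> X]L2; apply: cvgM; first exact: cvg_cst.
    exact: cvgM.
  exact: (cvgr_le _ H _ d0).
pose C := `|l| + 1.
have nh : \forall t \near F, `|dsmooth_pen (m t) (x t)| <= C.
  by apply: (cvgr_le _ (cvg_norm dpen_cvg)); rewrite ltrDl.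
(* [D] bounds the squared derivative of [phi^p]: its product with [psi'] is at most [C] in absolute
   value, and [psi'] is eventually at least [psi' 0 / 2]. *)
pose D := (C / (psi' 0 / 2)) ^+ 2.
apply/cvgryPge => A.
pose k := psi' 0 / 2 * p * d; have k0 : 0 < k by rewrite !mulr_gt0// invr_gt0.
pose B := `|A| + beta * D + 1.
have B0 : 0 < B by rewrite ltr_wpDl// addr_ge0// mulr_ge0 ?sqr_ge0// ltW.
(* The bound [1] gives [phi^(p-2) >= 1 / phi], as [p - 2 <= -1]; the bound [k / B] gives
   [k / phi >= B], enough to exceed [A] after the loss of [beta * D]. *)
have nu : \forall t \near F, u (m t) (x t) <= Num.min 1 (k / B).
  by apply: (cvgr_le _ u_cvg0); rewrite lt_min ltr01 divr_gt0.
near=> t.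
have t0 : 0 < m t by near: t.
have u0 := phi_gt0 (x t) t0; have Mu := phi_ge (x t) t0.
have uB : u (m t) (x t) <= Num.min 1 (k / B) by near: t.
have S1 : `|smooth_sgn (x t / m t)| < smooth_sgn a by near: t.
have S2 : (1 - p) * smooth_sgn (x t / m t) ^+ 2 <= d by near: t.
have h1 : `|dsmooth_pen (m t) (x t)| <= C by near: t.
have dp : psi' 0 / 2 <= psi' (u (m t) (x t) `^ p) by near: t.
have P0 : 0 < psi' 0 / 2 by rewrite divr_gt0.
have ra' := smooth_sgn_lt_density (ltW a0) S1.
have b2 := psi''_ge (powR_ge0 (u (m t) (x t)) p).
move: uB; rewrite le_min => /andP[u1 uB].
have up2 : (u (m t) (x t))^-1 <= u (m t) (x t) `^ (p - 2).
  rewrite -powR_inv1 ?(ltW u0)//; apply: ger_powR; first by rewrite u0.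
  by move: p_le1; lra.
have up1 : u (m t) (x t) `^ (p - 1) = u (m t) (x t) `^ (p - 2) * u (m t) (x t).
  rewrite -[X in _ = _ * X]powRr1 ?(ltW u0)// -powRD; first by congr (_ `^ _); ring.
  by apply/implyP => _; rewrite gt_eqF.
rewrite /ddsmooth_pen; rewrite /dsmooth_pen up1 in h1 *.
move: h1 up2 b2 S2 ra' Mu u0 uB dp t0.
set v := _ `^ (p - 2); set y := u _ _; set q := psi' (_ `^ _).
set q2 := psi'' _; set s := smooth_sgn _; set r := rho (_ / _).
set X := p * _ * s => h1 up2 b2 S2 ra' Mu u0 uB dp t0.
have q0 : 0 < q by apply: lt_le_trans dp.
have XD : X ^+ 2 <= D.
  rewrite -(real_normK (num_real X)) /D lerXn2r ?nnegrE//.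
    by rewrite divr_ge0// /C ?ltW// addr_ge0.
  rewrite ler_pdivlMr//; apply: le_trans h1.
  by rewrite (normrM q) (gtr0_norm q0) mulrC ler_wpM2r.
have H1 : - (beta * D) <= q2 * X ^+ 2.
  apply: (@le_trans _ _ (- beta * X ^+ 2)); last by rewrite ler_wpM2r ?sqr_ge0.
  by rewrite mulNr lerN2 ler_pM2l.
have H2 : 2 * d <= y * (2 * r / m t).
  have -> : y * (2 * r / m t) = 2 * (y * r / m t) by ring.
  rewrite ler_pM2l// ler_pdivlMr// (_ : d * m t = (m t * M) * rho a); last by rewrite /d; ring.
  apply: (@le_trans _ _ (y * rho a)); first by rewrite ler_pM2r.
  by rewrite ler_pM2l.
have v0 : 0 < v by apply: lt_le_trans up2; rewrite invr_gt0.
have H3 : p * y^-1 * d <= p * (p - 1) * v * s ^+ 2 + p * (v * y) * (2 * r / m t).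
  have -> : p * (p - 1) * v * s ^+ 2 + p * (v * y) * (2 * r / m t) =
    p * v * (y * (2 * r / m t) - (1 - p) * s ^+ 2) by ring.
  apply: (@le_trans _ _ (p * v * d)); first by rewrite ler_pM2r// ler_pM2l.
  by rewrite ler_pM2l ?mulr_gt0//; lra.
have H4 : k * y^-1 <= q * (p * (p - 1) * v * s ^+ 2 + p * (v * y) * (2 * r / m t)).
  have y0 : 0 < p * y^-1 * d by rewrite !mulr_gt0// invr_gt0.
  apply: (@le_trans _ _ (q * (p * y^-1 * d))); last by rewrite ler_pM2l.
  have -> : k * y^-1 = psi' 0 / 2 * (p * y^-1 * d) by rewrite /k; ring.
  by rewrite ler_pM2r.
have H5 : B <= k * y^-1 by rewrite ler_pdivlMr// mulrC -ler_pdivlMr.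
have := ler_norm A; rewrite /B in H5; lra.
Unshelve. all: end_near. Qed.

End Zero.

End Limits.

(** * Gradient and diagonal Hessian of the smoothed penalty *)

Lemma partial_varphi {n} mu i (w : 'cV[R]_n) : 0 < mu ->
  partial i (varphi psi rho p mu) w = dsmooth_pen mu (w i 0).
Proof.
move=> mu0; rewrite (partial_separable (fun y => psi (u mu y `^ p))).
by apply: derive_val; exact: is_derive_smooth_pen.
Qed.

Lemma hess_varphi {n} mu (w : 'cV[R]_n) i j : 0 < mu ->
  hess (varphi psi rho p mu) w i j = if i == j then ddsmooth_pen mu (w i 0) else 0.
Proof.
move=> mu0; rewrite mxE.
have -> : partial i (varphi psi rho p mu) = fun v : 'cV[R]_n => dsmooth_pen mu (v i 0).
  by apply/funext => v; exact: partial_varphi.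
rewrite partial_coord; case: ifP => // _.
by apply: derive_val; exact: is_derive_dsmooth_pen.
Qed.

End Density.

(** * Passage to the limit in the approximate KKT system *)

Theorem theorem4p1 (R : realType) (n r : nat)
    (f g : 'cV[R]_n.+1 -> R) (Rs : 'I_r -> 'cV[R]_n.+1 -> R)
    (p eps alpha beta : R) (psi rho : R -> R)
    (beta1 beta2 : R) (mu epshat : nat -> R) (z : nat -> iterate R n.+1 r)
    (w : 'cV[R]_n.+1) (lam : 'cV[R]_r.+1)
    (zeta : 'cV[R]_n.+1) (eta : 'cV[R]_r.+1)
    (f_C1 : C1 f) (g_C2 : C2 g) (Rs_C2 : forall j, C2 (Rs j))
    (p_01 : 0 < p <= 1) (eps_gt0 : 0 < eps)
    (alpha_gt0 : 0 < alpha) (beta_gt0 : 0 < beta)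
    (psi_C2 : C2_nneg psi)
    (psi'_bnd : forall t : R, 0 <= t -> 0 < deriv_nneg psi t <= alpha)
    (psi''_bnd : forall t : R, 0 <= t -> - beta <= deriv_nneg (deriv_nneg psi) t <= 0)
    (rho_density : is_density rho)
    (rho_moment : finite_first_moment rho)
    (rho_even : forall x, rho x = rho (- x))
    (rho_cont : continuous rho)
    (rho_noninc : forall x y : R, 0 <= x -> x <= y -> rho y <= rho x)
    (rho_tail : exists c q : R, [/\ 0 < c, 0 < q & forall S : R, 0 <= S ->
       1 - c / (S `^ q + c) <= 2 * \int[lebesgue_measure]_(x in `[0, S]) rho x])
    (rho_pos : p = 1 -> forall x, 0 < rho x)
    (z_algo : smoothing_algorithm f g Rs p eps psi rho beta1 beta2 mu epshat z)
    (z_accum : cluster (z @ \oo) (w, lam, zeta, eta))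
    (max_lt : p = 1 -> forall i, i \in zero_set w ->
       `|partial i (Gfun g Rs (lbar lam)) w| < lam ord0 0 * deriv_nneg psi 0) :
  BKKT f g Rs p eps psi w lam.
Proof.
have [F [FF Foo zF]] := cluster_filter z_accum.
pose W k := (z k).1.1.1; pose L k := (z k).1.1.2.
pose Z k := (z k).1.2; pose E k := (z k).2.
have zE k : z k = (W k, L k, Z k, E k) by rewrite /W /L /Z /E; case: (z k) => -[[]].
have Wc : W @ F --> w.
  exact: (cvg_comp _ _ (cvg_comp _ _ (cvg_comp _ _ zF cvg_fst) cvg_fst) cvg_fst).
have Lc : L @ F --> lam.
  exact: (cvg_comp _ _ (cvg_comp _ _ (cvg_comp _ _ zF cvg_fst) cvg_fst) cvg_snd).
have Zc : Z @ F --> zeta.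
  exact: (cvg_comp _ _ (cvg_comp _ _ zF cvg_fst) cvg_snd).
have Ec : E @ F --> eta by exact: (cvg_comp _ _ zF cvg_snd).
have [mu0 /andP[b1 b1'] /andP[b2 b2'] _ step] := z_algo.
have muE k : mu k = mu 0%N * beta1 ^+ k.
  elim: k => [|k IH]; first by rewrite expr0 mulr1.
  by have [_ -> _] := step k; rewrite IH exprS mulrCA.
have epsE k : epshat k = epshat 0%N * beta2 ^+ k.
  elim: k => [|k IH]; first by rewrite expr0 mulr1.
  by have [_ _ ->] := step k; rewrite IH exprS mulrCA.
have geo (a b : R) : 0 < b -> b < 1 -> a * b ^+ k.-1 @[k --> F] --> 0.
  move=> b0 b1''; apply: (cvg_trans (G := a * b ^+ k.-1 @[k --> \oo])).
    by move=> A; exact: Foo.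
  rewrite -cvg_shiftS; apply: cvg_geometric; by rewrite gtr0_norm.
(* The shift matches the indexing of the algorithm: [z k.+1] is computed with [mu k] and
   [epshat k]. *)
pose m k := mu k.-1; pose e k := epshat k.-1.
have mc : m @ F --> 0 by rewrite /m; under eq_fun do rewrite muE; exact: geo.
have ec : e @ F --> 0 by rewrite /e; under eq_fun do rewrite epsE; exact: geo.
have m0 k : 0 < m k by rewrite /m muE mulr_gt0// exprn_gt0.
have mF : \forall k \near F, 0 < m k by exact: nearW.
pose d k i := dsmooth_pen rho psi p (m k) (W k i 0).
pose dd k i := ddsmooth_pen rho psi p (m k) (W k i 0).
pose G k := Gfun g Rs (lbar (L k)).
pose V k : 'cV[R]_n.+1 -> R := varphi psi rho p (m k).
have res : \forall k \near F,
  [/\ forall i, `|partial i f (W k) + (\sum_j hess (G k) (W k) i j * Z k j 0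
                   + L k 0 0 * dd k i * Z k i 0)| <= e k,
      `|\sum_i d k i * Z k i 0 - E k 0 0| <= e k,
      forall j, `|\sum_i partial i (Rs j) (W k) * Z k i 0 - E k (lift ord0 j) 0| <= e k,
      forall i, `|partial i (G k) (W k) + L k 0 0 * d k i| <= e k
    & [/\ forall i, 0 <= (L k - eps *: delta_mx ord0 0) i 0,
          forall i, 0 <= E k i 0
        & `|dotv (L k - eps *: delta_mx ord0 0) (E k)| <= e k]].
  (* [z 0] is unconstrained, so the system is only claimed on a tail, where [k > 0]. *)
  apply: Foo; near=> k.
  have k0 : (0 < k)%N by near: k; exact: nbhs_infty_gt.
  have [+ _ _] := step k.-1; rewrite prednK// zE => /approx_KKT_residuals.
  have pv i : partial i (V k) (W k) = d k i.
    by apply: partial_varphi => //; exact: m0.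
  have hv i j : hess (V k) (W k) i j = if i == j then dd k i else 0.
    exact: (hess_varphi rho_density rho_moment rho_even rho_cont rho_noninc
      rho_tail _ psi_C2 _ _ _ (m0 k)).
  case=> r1 r2 r3 r4 r5; split; [|..|exact: r5].
  - move=> i; have := r1 i.
    (* The Hessian of the smoothed penalty is diagonal, so its part of the sum reduces to the term
       [j = i]. *)
    have -> : \sum_j (hess (G k) (W k) i j
        + L k 0 0 * hess (V k) (W k) i j) * Z k j 0 =
        \sum_j hess (G k) (W k) i j * Z k j 0 + L k 0 0 * dd k i * Z k i 0.
      rewrite (eq_bigr (fun j => hess (G k) (W k) i j * Z k j 0 +
          L k 0 0 * (if i == j then dd k i else 0) * Z k j 0)); last first.
        move=> j _; rewrite -[RHS]mulrDl.
        exact: (congr1 (fun x => (_ + L k 0 0 * x) * Z k j 0) (hv i j)).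
      rewrite big_split/=; congr (_ + _); rewrite (bigD1 i)//= eqxx big1 ?addr0// => j ji.
      by rewrite eq_sym (negbTE ji) mulr0 mul0r.
    exact.
  - have -> : \sum_i d k i * Z k i 0 = \sum_i partial i (V k) (W k) * Z k i 0.
      by apply: eq_bigr => i _; rewrite pv.
    exact: r2.
  - exact: r3.
  - by move=> i; rewrite -pv; exact: r4.
have [r1 r2 r3 r4 [r5 r6 r7]] : [/\ 
    forall i, partial i f (W k) + (\sum_j hess (G k) (W k) i j * Z k j 0
                   + L k 0 0 * dd k i * Z k i 0) @[k --> F] --> 0,
    \sum_i d k i * Z k i 0 - E k 0 0 @[k --> F] --> 0,
    forall j, \sum_i partial i (Rs j) (W k) * Z k i 0 - E k (lift ord0 j) 0 @[k --> F] --> 0,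
    forall i, partial i (G k) (W k) + L k 0 0 * d k i @[k --> F] --> 0
  & [/\ forall i, \forall k \near F, 0 <= (L k - eps *: delta_mx ord0 0) i 0,
        forall i, \forall k \near F, 0 <= E k i 0
      & dotv (L k - eps *: delta_mx ord0 0) (E k) @[k --> F] --> 0]].
  split=> [i||j|i|]; [..|split=> [i|i|]].
  - by apply: (cvg0_of_le _ ec); apply: filterS res => k [].
  - by apply: (cvg0_of_le _ ec); apply: filterS res => k [].
  - by apply: (cvg0_of_le _ ec); apply: filterS res => k [].
  - by apply: (cvg0_of_le _ ec); apply: filterS res => k [].
  - by apply: filterS res => k [_ _ _ _ []].
  - by apply: filterS res => k [_ _ _ _ []].
  - by apply: (cvg0_of_le _ ec); apply: filterS res => k [_ _ _ _ []].
clear res.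
have Lec i : (L k - eps *: delta_mx ord0 0) i 0 @[k --> F] -->
    (lam - eps *: delta_mx ord0 0) i 0.
  rewrite 2!mxE; under eq_fun do rewrite 2!mxE.
  by apply: cvgB; [exact: cvg_coord|exact: cvg_cst].
have lam_ge i : 0 <= (lam - eps *: delta_mx ord0 0) i 0.
  exact: (ler_cvg_to (cvg_cst 0) (Lec i) (r5 i)).
have Eic i : E k i 0 @[k --> F] --> eta i 0 by exact: cvg_coord.
have Zic i : Z k i 0 @[k --> F] --> zeta i 0 by exact: cvg_coord.
have Wic i : W k i 0 @[k --> F] --> w i 0 by exact: cvg_coord.
have eta_ge i : 0 <= eta i 0.
  exact: (ler_cvg_to (cvg_cst 0) (Eic i) (r6 i)).
(* The constraint that [lambda_1] is at least [eps > 0] survives in the limit, which allows division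
   by [lambda_1] below. *)
have lam0 : 0 < lam 0 0.
  by have := lam_ge 0; rewrite !mxE !eqxx mulr1 subr_ge0; exact: lt_le_trans.
have L0 : \forall k \near F, 0 < L k 0 0.
  apply: filterS (r5 0) => k; rewrite !mxE !eqxx mulr1 subr_ge0; exact: lt_le_trans.
have L0c : L k 0 0 @[k --> F] --> lam 0 0 by exact: cvg_coord.
have pG lb i : partial i (Gfun g Rs lb) = Gfun (partial i g) (fun k => partial i (Rs k)) lb.
  by apply: partial_Gfun => [v|k v]; [case: g_C2 => -[]|case: (Rs_C2 k) => -[]].
have pGc i : partial i (G k) (W k) @[k --> F] --> partial i (Gfun g Rs (lbar lam)) w.
  rewrite pG /G; under eq_fun do rewrite pG.
  by apply: Gfun_cvg => //; [case: g_C2 => -[]|move=> k; case: (Rs_C2 k) => -[]].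
have hGc i j : hess (G k) (W k) i j @[k --> F] --> hess (Gfun g Rs (lbar lam)) w i j.
  have hG lb v := hess_Gfun (g := g) (Rs := Rs) lb v i j g_C2 Rs_C2.
  rewrite [X in _ --> X](hG (lbar lam) w).
  rewrite (funext (fun k => hG (lbar (L k)) (W k))).
  apply: Gfun_cvg => //; first by case: g_C2 => _ /(_ i)[].
  by move=> k; case: (Rs_C2 k) => _ /(_ i)[].
(* Solving the stationarity equation for the penalty derivative shows that it converges at every
   coordinate, including those tending to zero. *)
pose l i := - partial i (Gfun g Rs (lbar lam)) w / lam 0 0.
have dc i : d k i @[k --> F] --> l i.
  have H : (partial i (G k) (W k) + L k 0 0 * d k i - partial i (G k) (W k)) / L k 0 0
      @[k --> F] --> (0 - partial i (Gfun g Rs (lbar lam)) w) / lam 0 0.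
    by apply: cvgM; [exact: cvgB|apply: cvgV; rewrite ?gt_eqF].
  rewrite sub0r in H; apply: cvg_trans H; apply: near_eq_cvg.
  by apply: filterS L0 => k L0; rewrite addrAC subrr add0r mulrAC divff ?mul1r// gt_eqF.
have uniq (h : nat -> R) (a b : R) : h @ F --> a -> h @ F --> b -> a = b.
  by move=> ha hb; rewrite -(cvg_lim (@Rhausdorff R) ha) -(cvg_lim (@Rhausdorff R) hb).
have [p0 p1] := andP p_01.
have fc i : partial i f (W k) @[k --> F] --> partial i f w.
  exact: (cvg_comp _ _ Wc (f_C1.2 i w)).
have Hc i : \sum_j hess (G k) (W k) i j * Z k j 0 @[k --> F] -->
    \sum_j hess (Gfun g Rs (lbar lam)) w i j * zeta j 0.
  by apply: cvg_sum => j _; apply: cvgM.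
have notin i : i \notin zero_set w -> w i 0 != 0 by rewrite inE.
have zeta0 i : i \in zero_set w -> zeta i 0 = 0.
  move=> iI; have wi0 : w i 0 = 0 by move: iI; rewrite inE => /eqP.
  have [psi0 _] := andP (psi'_bnd 0 (lexx 0)).
  have psi2_ge (t : R) : 0 <= t -> - beta <= deriv_nneg (deriv_nneg psi) t.
    by move=> /psi''_bnd/andP[].
  have l_lt : p = 1 -> `|l i| < deriv_nneg psi 0.
    move=> /max_lt/(_ _ iI); rewrite /l mulNr normrN normrM.
    by rewrite (gtr0_norm (x := _^-1)) ?invr_gt0// ltr_pdivrMr// mulrC.
  have ddy := ddsmooth_pen_cvgy rho_density rho_moment rho_even rho_cont rho_noninc
      rho_tail psi_C2 (FF := FF) mF mc (Wic i) p0 wi0 p1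
      beta_gt0 psi0 psi2_ge rho_pos (dc i) l_lt.
  have ddpos : \forall k \near F, 0 < dd k i.
    by have /cvgryPgt/(_ 0) := (ddy : dd k i @[k --> F] --> +oo%R).
  have ddV : (dd k i)^-1 @[k --> F] --> 0.
    have := (gtr0_cvgV0 (f := dd^~ i) ddpos).2 ddy. exact.
  (* All other terms of the first KKT equation converge, so [lambda_1 * dd * zeta_i] has the finite
     limit [c]; dividing by [lambda_1] and by [dd], which tends to [+oo], sends [zeta_i] to [0]. *)
  pose c := 0 - partial i f w - \sum_j hess (Gfun g Rs (lbar lam)) w i j * zeta j 0.
  have prod : L k 0 0 * dd k i * Z k i 0 @[k --> F] --> c.
    have H : (partial i f (W k) + (\sum_j hess (G k) (W k) i j * Z k j 0
        + L k 0 0 * dd k i * Z k i 0) - partial i f (W k)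
        - \sum_j hess (G k) (W k) i j * Z k j 0) @[k --> F] --> c.
      by apply: cvgB (Hc i); apply: cvgB (fc i); exact: r1.
    apply: cvg_trans H; apply: near_eq_cvg; apply: nearW => k; ring.
  have : L k 0 0 * dd k i * Z k i 0 * (L k 0 0)^-1 * (dd k i)^-1 @[k --> F] -->
      c * (lam 0 0)^-1 * 0.
    by apply: cvgM => //; apply: cvgM => //; apply: cvgV => //; rewrite gt_eqF.
  rewrite mulr0 => H; apply: uniq (Zic i) _; apply: cvg_trans H; apply: near_eq_cvg.
  by apply: filterS2 L0 ddpos => k L0 d0; field; rewrite !gt_eqF.
(* Uniqueness of limits: the penalty derivative converges both to [l i] and to the derivative of the
   unsmoothed penalty. *)
have lE i : i \notin zero_set w ->
    l i = deriv_nneg psi (`|w i 0| `^ p) * (p * `|w i 0| `^ (p - 1) * Num.sg (w i 0)).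
  move=> iI; apply: uniq (dc i) _.
  exact: (dsmooth_pen_cvg rho_density rho_moment rho_even rho_cont rho_noninc
    rho_tail psi_C2 (FF := FF) mF mc (Wic i) p0 (notin i iI)).
exists zeta, eta; split.
- move=> i iI.
  have := ddsmooth_pen_cvg rho_density rho_moment rho_even rho_cont rho_noninc
    rho_tail psi_C2 (FF := FF) mF mc (Wic i) p0 (notin i iI).
  set DD := (X in _ --> X) => ddc.
  have H : partial i f w + (\sum_j hess (Gfun g Rs (lbar lam)) w i j * zeta j 0
      + lam 0 0 * DD * zeta i 0) = 0.
    apply: uniq (r1 i); apply: cvgD; first exact: fc.
    apply: cvgD; first exact: Hc.
    by apply: cvgM => //; apply: cvgM.
  apply: etrans H; congr (_ + _).
  (* Columns in the zero set vanish because [zeta] does there, leaving the reduced Hessian. *)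
  rewrite [X in _ = X + _](bigID [pred j | j \notin zero_set w])/=.
  rewrite [X in _ = _ + X + _]big1 ?addr0; last first.
    by move=> j; rewrite negbK => /zeta0 ->; rewrite mulr0.
  rewrite (bigD1 i)//= [X in _ = X + _](bigD1 i)//=.
  rewrite (eq_bigr (fun j => hess (Gfun g Rs (lbar lam)) w i j * zeta j 0)); last first.
    by move=> j /andP[_ ji]; rewrite /Htilde eq_sym (negbTE ji) addr0.
  rewrite /Htilde eqxx /DD; ring.
- move=> i iI; have := lE i iI; rewrite /l => /(congr1 (fun x => x * lam 0 0)).
  rewrite divfK ?gt_eqF// => /eqP; rewrite eqr_oppLR => /eqP ->; ring.
- exact: zeta0.
(* The limit is first taken over all coordinates: [l i] is finite even on the zero set, where
   [zeta i 0 = 0] then removes the term. *)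
- have <- : \sum_i l i * zeta i 0 = eta ord0 0.
    apply/eqP; rewrite -subr_eq0; apply/eqP; apply: uniq r2; apply: cvgB; last exact: Eic.
    by apply: cvg_sum => i _; apply: cvgM.
  rewrite [RHS](bigID [pred j | j \notin zero_set w])/=.
  rewrite [X in _ = _ + X]big1 ?addr0; last first.
    by move=> j; rewrite negbK => /zeta0 ->; rewrite mulr0.
  rewrite mulr_sumr; apply: eq_bigr => i iI; rewrite lE//; ring.
split=> //.
- move=> j; have H : \sum_i partial i (Rs j) w * zeta i 0 - eta (lift ord0 j) 0 = 0.
    apply: uniq (r3 j); apply: cvgB; last exact: Eic.
    apply: cvg_sum => i _; apply: cvgM; last exact: Zic.
    exact: (cvg_comp _ _ Wc ((Rs_C2 j).1.2 i w)).
  apply/eqP; rewrite -subr_eq0; apply/eqP; apply: etrans H; congr (_ - _).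
  rewrite [RHS](bigID [pred j | j \notin zero_set w])/= [X in _ = _ + X]big1 ?addr0//.
  by move=> i; rewrite negbK => /zeta0 ->; rewrite mulr0.
- apply: uniq r7; rewrite /dotv; apply: cvg_sum => i _; apply: cvgM; last exact: Eic.
  exact: Lec.
Unshelve. all: by end_near.
Qed.
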